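(* Let $(L,[,\ldots,],\alpha=(\alpha_1,\ldots,\alpha_{n-1}))$ be an $n$-ary Hom-Nambu-Lie algebra with $n\ge 3$. Suppose $a\in L$ satisfies $\alpha_1(a)=a$. Then $$L'=(L,[,\ldots,]',\alpha'=(\alpha_2,\ldots,\alpha_{n-1})),\qquad [x_1,\ldots,x_{n-1}]'=[a,x_1,\ldots,x_{n-1}]\ \ (x_i\in L),$$ is an $(n-1)$-ary Hom-Nambu-Lie algebra. Moreover, if $L$ is multiplicative, then so is $L'$.
   Context: We work over a fixed field $\mathbf{k}$ of characteristic $0$. For an integer $n\ge 2$, an $n$-ary Hom-algebra $(V,[,\ldots,],\alpha=(\alpha_1,\ldots,\alpha_{n-1}))$ consists of a $\mathbf{k}$-module $V$, an $n$-linear map $[,\ldots,]\colon V^{\otimes n}\to V$, and linear maps $\alpha_i\colon V\to V$ ($1\le i\le n-1$), called twisting maps. It is multiplicative if $\alpha_1=\cdots=\alpha_{n-1}=\alpha$ and $\alpha\circ[,\ldots,]=[,\ldots,]\circ\alpha^{\otimes n}$. The product is anti-symmetric if $[x_1,\ldots,x_n]=\epsilon(\sigma)[x_{\sigma(1)},\ldots,x_{\sigma(n)}]$ for all $x_i\in V$ and all permutations $\sigma$ of $n$ letters, with $\epsilon(\sigma)$ the signature of $\sigma$. An $n$-ary Hom-Nambu-Lie algebra is an $n$-ary Hom-algebra whose product is anti-symmetric and which satisfies the $n$-ary Hom-Nambu identity $$[\alpha_1(x_1),\ldots,\alpha_{n-1}(x_{n-1}),[y_1,\ldots,y_n]]=\sum_{i=1}^n[\alpha_1(y_1),\ldots,\alpha_{i-1}(y_{i-1}),[x_1,\ldots,x_{n-1},y_i],\alpha_i(y_{i+1}),\ldots,\alpha_{n-1}(y_n)]$$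 for all $x_1,\ldots,x_{n-1},y_1,\ldots,y_n\in V$. *)

(* Defs.v *)
From HB Require Import structures.
From mathcomp Require Import all_boot all_order all_algebra all_fingroup.

Set Implicit Arguments.
Unset Strict Implicit.
Unset Printing Implicit Defensive.

Import GRing.Theory.
Local Open Scope ring_scope.

(* Throughout, the arity is n = m.+1, and m = n - 1 is the number of twisting
   maps.  The indices are 0-based: 'I_m.+1 for the arguments of the bracket and
   'I_m for the twisting maps. *)

Section HomNambuLie.
Variables (k : fieldType) (V : lmodType k) (m : nat).

(* The (m+1)-tuple (x_0, .., x_{i-1}, v, x_i, .., x_{m-1}), with v at index i. *)
Definition insert (i : 'I_m.+1) (v : V) (x : {ffun 'I_m -> V}) :
    {ffun 'I_m.+1 -> V} :=
  [ffun j => if unlift i j is Some l then x l else v].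

Definition multilinear (br : {ffun 'I_m.+1 -> V} -> V) : Prop :=
  forall (i : 'I_m.+1) (x : {ffun 'I_m -> V}), linear (fun v => br (insert i v x)).

Definition antisymmetric_bracket (br : {ffun 'I_m.+1 -> V} -> V) : Prop :=
  forall (x : {ffun 'I_m.+1 -> V}) (s : 'S_m.+1),
    br x = (-1) ^+ s *: br [ffun i => x (s i)].

(* In the i-th summand, lift i l is l for l < i and l + 1 for l >= i, so that
   al_l is applied to y_l on the left of the inner bracket and to y_{l+1} on
   its right. *)
Definition hom_nambu_identity (br : {ffun 'I_m.+1 -> V} -> V)
    (al : 'I_m -> {linear V -> V}) : Prop :=
  forall (x : {ffun 'I_m -> V}) (y : {ffun 'I_m.+1 -> V}),
    br (insert ord_max (br y) [ffun l => al l (x l)]) =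
    \sum_(i < m.+1)
      br (insert i (br (insert ord_max (y i) x)) [ffun l => al l (y (lift i l))]).

Definition hom_nambu_lie (br : {ffun 'I_m.+1 -> V} -> V)
    (al : 'I_m -> {linear V -> V}) : Prop :=
  [/\ (2 <= m.+1)%N, multilinear br, antisymmetric_bracket br
    & hom_nambu_identity br al].

Definition hom_multiplicative (br : {ffun 'I_m.+1 -> V} -> V)
    (al : 'I_m -> {linear V -> V}) : Prop :=
  exists alpha : {linear V -> V},
    (forall l, al l =1 alpha) /\
    (forall x : {ffun 'I_m.+1 -> V}, alpha (br x) = br [ffun i => alpha (x i)]).

End HomNambuLie.

Section Contraction.
Variables (k : fieldType) (V : lmodType k) (m : nat).

Definition contract_bracket (br : {ffun 'I_m.+2 -> V} -> V) (a : V) :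
    {ffun 'I_m.+1 -> V} -> V :=
  fun x => br (insert ord0 a x).

Definition contract_twist (al : 'I_m.+1 -> {linear V -> V}) :
    'I_m -> {linear V -> V} :=
  fun l => al (lift ord0 l).

End Contraction.

(* Main.v *)
Require Import Defs.
From HB Require Import structures.
From mathcomp Require Import all_boot all_order all_algebra all_fingroup.

Set Implicit Arguments.
Unset Strict Implicit.
Unset Printing Implicit Defensive.

Import GRing.Theory.
Local Open Scope ring_scope.

(* Apply the Hom-Nambu identity of L to (a, x_1, .., x_{n-2}) and
   (a, y_1, .., y_{n-1}).  As alpha_1 fixes a, this is the identity of L' up to
   the first summand, whose inner bracket [a, x_1, .., x_{n-2}, a] vanishes by
   antisymmetry. *)

Section Insert.
Variables (k : fieldType) (V : lmodType k) (m : nat).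

Lemma insert_id (i : 'I_m.+1) (v : V) (x : {ffun 'I_m -> V}) :
  insert i v x i = v.
Proof. by rewrite ffunE unlift_none. Qed.

Lemma insert_lift (i : 'I_m.+1) (v : V) (x : {ffun 'I_m -> V}) l :
  insert i v x (lift i l) = x l.
Proof. by rewrite ffunE liftK. Qed.

(** Every index is either [i] or some [lift i l]. Each equality of tuples below reduces to these two
    cases. *)
Lemma insert_unique (i : 'I_m.+1) (v : V) (x : {ffun 'I_m -> V})
    (z : {ffun 'I_m.+1 -> V}) :
  z i = v -> (forall l, z (lift i l) = x l) -> z = insert i v x.
Proof.
move=> zi zl; apply/ffunP => j; rewrite ffunE.
by case: unliftP => [l ->|->]; [exact: zl | exact: zi].
Qed.

End Insert.

Lemma lift_lift0 m (i : 'I_m.+1) (l : 'I_m) :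
  lift (lift ord0 i) (lift ord0 l) = lift ord0 (lift i l).
Proof. by apply: val_inj; rewrite /= bumpS. Qed.

Lemma lift_lift0_ord0 m (i : 'I_m.+1) : lift (lift ord0 i) ord0 = ord0.
Proof. exact: val_inj. Qed.

Lemma lift0_ord_max m : ord_max = lift ord0 ord_max :> 'I_m.+2.
Proof. exact: val_inj. Qed.

(** This lets a bracket of [L] with [a] somewhere inside be read as a contracted bracket: [a] moves
    to the front, and slot [i] of the shorter tuple is slot [i + 1] of the longer one. *)
Lemma insert_insert0 (k : fieldType) (V : lmodType k) m (i : 'I_m.+1)
    (v a : V) (x : {ffun 'I_m -> V}) :
  insert (lift ord0 i) v (insert ord0 a x) = insert ord0 a (insert i v x).
Proof.
apply: insert_unique => [|j].
  by rewrite -{2}(lift_lift0_ord0 i) insert_lift insert_id.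
case: (unliftP i j) => [l ->|->]; last by rewrite !insert_id.
by rewrite -lift_lift0 !insert_lift.
Qed.

Section Bracket.
Variables (k : fieldType) (V : lmodType k) (m : nat).
Variable br : {ffun 'I_m.+1 -> V} -> V.

Lemma multilinear_insert0 (i : 'I_m.+1) (x : {ffun 'I_m -> V}) :
  multilinear br -> br (insert i 0 x) = 0.
Proof.
(* With both vectors zero and scalar -1, linearity gives f(0) = -f(0) + f(0). *)
move=> br_lin; have := br_lin i x (-1) 0 0.
by rewrite scaler0 addr0 scaleN1r addNr.
Qed.

(** The transposition of [i] and [j] is odd and fixes [x], so twice the bracket is zero, and 2 is
    invertible in characteristic 0. *)
Lemma antisymmetric_eq0 (x : {ffun 'I_m.+1 -> V}) (i j : 'I_m.+1) :
  [pchar k] =i pred0 -> antisymmetric_bracket br -> i != j -> x i = x j ->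
  br x = 0.
Proof.
move=> k_char0 br_anti neq_ij xij.
have := br_anti x (tperm i j).
rewrite odd_tperm neq_ij expr1 scaleN1r.
have -> : [ffun l => x (tperm i j l)] = x.
  by apply/ffunP => l; rewrite ffunE; case: tpermP => // ->.
move/eqP; rewrite -addr_eq0 -mulr2n -scaler_nat scaler_eq0.
have /negbT := k_char0 2%N.
by rewrite !inE /= => /negbTE ->; move/eqP.
Qed.

End Bracket.

Section Contraction.
Variables (k : fieldType) (L : lmodType k) (m : nat).
Variables (br : {ffun 'I_m.+2 -> L} -> L) (a : L).

Lemma contract_multilinear : multilinear br -> multilinear (contract_bracket br a).
Proof.
move=> br_lin i x c u v; rewrite /contract_bracket -!insert_insert0.
exact: br_lin.
Qed.

(** Extend [s] to a permutation of all slots of [br] that fixes slot 0, where [a] sits; the sign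
    does not change. *)
Lemma contract_antisymmetric :
  antisymmetric_bracket br -> antisymmetric_bracket (contract_bracket br a).
Proof.
move=> br_anti x s; rewrite /contract_bracket.
rewrite (br_anti _ (lift_perm ord0 ord0 s)) odd_lift_perm /=.
congr (_ *: br _); apply: insert_unique => [|l].
  by rewrite ffunE lift_perm_id insert_id.
by rewrite !ffunE lift_perm_lift liftK.
Qed.

Variable al : 'I_m.+1 -> {linear L -> L}.
Hypothesis al0a : al ord0 a = a.

Lemma contract_hom_nambu :
    [pchar k] =i pred0 -> multilinear br -> antisymmetric_bracket br ->
    hom_nambu_identity br al ->
  hom_nambu_identity (contract_bracket br a) (contract_twist al).
Proof.
move=> k_char0 br_lin br_anti br_nambu x y; rewrite /contract_bracket.
have := br_nambu (insert ord0 a x) (insert ord0 a y).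
rewrite big_ord_recl insert_id [br (insert ord_max a _)](antisymmetric_eq0
  (i := ord0) (j := ord_max)) //; first last.
  by rewrite insert_id lift0_ord_max insert_insert0 insert_id.
rewrite multilinear_insert0 // add0r.
(* The entry at 0 is [al ord0 a], which is [a]; the others carry the shifted twisting maps. *)
have -> : [ffun l => al l (insert ord0 a x l)]
    = insert ord0 a [ffun l => contract_twist al l (x l)].
  apply: insert_unique => [|l]; first by rewrite ffunE insert_id.
  by rewrite [LHS]ffunE [RHS]ffunE insert_lift.
rewrite lift0_ord_max insert_insert0 => ->.
apply: eq_bigr => i _; rewrite insert_lift insert_insert0 -(insert_insert0 i).
(* In these summands the inner bracket lies to the right of slot 0, so the first outer entry is
   again [al ord0 a = a]. *)
congr (br (insert _ _ _)); apply: insert_unique => [|l].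
  by rewrite ffunE lift_lift0_ord0 insert_id.
by rewrite [LHS]ffunE [RHS]ffunE lift_lift0 insert_lift.
Qed.

Lemma contract_multiplicative :
  hom_multiplicative br al ->
  hom_multiplicative (contract_bracket br a) (contract_twist al).
Proof.
case=> alpha [alE alpha_br]; exists alpha; split=> [l|x]; first exact: alE.
rewrite /contract_bracket alpha_br; congr br; apply: insert_unique => [|l].
  (* The common twisting map [alpha] agrees with [al ord0], hence fixes [a]. *)
  by rewrite ffunE insert_id -(alE ord0).
by rewrite [LHS]ffunE [RHS]ffunE insert_lift.
Qed.

End Contraction.

Theorem corollary6p3 (k : fieldType) (k_char0 : [pchar k] =i pred0)
    (L : lmodType k) (m : nat) (n_ge3 : (3 <= m.+2)%N)
    (br : {ffun 'I_m.+2 -> L} -> L) (al : 'I_m.+1 -> {linear L -> L})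
    (hL : hom_nambu_lie br al) (a : L) (ha : al ord0 a = a) :
  hom_nambu_lie (contract_bracket br a) (contract_twist al) /\
  (hom_multiplicative br al ->
   hom_multiplicative (contract_bracket br a) (contract_twist al)).
Proof.
case: hL => _ br_lin br_anti br_nambu; split; last exact: contract_multiplicative.
split=> //; first exact: contract_multilinear.
  exact: contract_antisymmetric.
exact: contract_hom_nambu.
Qed.
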